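(* Let $D_2(x,y,q)$ be the generating series of $d_2$-symmetric parallelogram polyominoes, with $x$, $y$, $q$ marking the width, the height and the area. Then $$D_2(x,y,q)=D\!\left(\frac{xy}{q},\,q^2\right),$$ where $D(y,q)$ is the generating series of Dyck polyominoes with $y$ marking the height and $q$ marking the area.
   Context: A parallelogram polyomino is a finite nonempty connected set of unit cells of the square lattice, considered up to translation, whose intersection with every row and every column of cells is a contiguous block (or empty), and which contains the bottom-left and the top-right cells of its minimal bounding rectangle. Equivalently, with columns numbered $1,\dots,w$ from left to right, column $i$ occupies the rows $b_i,\dots,t_i$ with $b_i\le b_{i+1}\le t_i\le t_{i+1}$ for $1\le i<w$. Width and height are those of the minimal bounding rectangle; the area is the number of cells. Let $d_2$ be the reflection about a line parallel to the bisector of the first quadrant (direction $y=x$). A polyomino is $d_2$-symmetric if it equals, up to translation, its image under $d_2$. A Dyck polyomino of height $h\ge1$ is a set of unit cells formed by $h$ rows, numbered $1,\dots,h$ from bottom to top, where row $i$ occupies the columns $a_i,\dots,i$ with $a_1=1$, $a_i\le a_{i+1}$ and $a_{i+1}\le i$ for $1\le i<h$. Its generating series is $$D(y,q)=\frac{\sum_{m\ge0}\frac{(-1)^my^{m+1}q^{(m+1)^2}}{(q)_m}}{\sum_{m\ge0}\frac{(-1)^my^mq^{m(m+1)}}{(q)_m}}=\sum_{n\ge1}y^nq^{2n-1}c_{n-1}(q),$$ where $(q)_m=\prod_{i=1}^m(1-q^i)$, $c_0(q)=1$ and $c_n(q)=\sum_{k=0}^{n-1}q^kc_k(q)c_{n-1-k}(q)$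 for $n\ge1$. *)

(* Defs.v *)
From HB Require Import structures.
From mathcomp Require Import all_boot all_order all_algebra.
From mathcomp Require Import finmap.
From mathcomp Require Import boolp classical_sets functions cardinality fsbigop.

Set Implicit Arguments.
Unset Strict Implicit.
Unset Printing Implicit Defensive.

Import Order.TTheory GRing.Theory Num.Theory.

Local Open Scope classical_set_scope.
Local Open Scope ring_scope.

(* The pair (i, j) stands for the unit cell in column i (counted from left to
   right) and row j (counted from bottom to top). *)
Notation cell := (int * int)%type.

Definition adjacent (c d : cell) : bool :=
  `|c.1 - d.1| + `|c.2 - d.2| == 1.

Definition connected_cells (P : {fset cell}) : Prop :=
  forall u v : P,
    connect (fun c d : P => adjacent (fsval c) (fsval d)) u v.

Definition rows_contiguous (P : {fset cell}) : Prop :=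
  forall i1 i i2 j : int, (i1, j) \in P -> (i2, j) \in P ->
    i1 <= i -> i <= i2 -> (i, j) \in P.

Definition columns_contiguous (P : {fset cell}) : Prop :=
  forall i j1 j j2 : int, (i, j1) \in P -> (i, j2) \in P ->
    j1 <= j -> j <= j2 -> (i, j) \in P.

(* Rectangle of w columns and h rows with bottom-left cell o. *)
Definition rectangle (o : cell) (w h : nat) : set cell :=
  [set c | o.1 <= c.1 < o.1 + w%:Z /\ o.2 <= c.2 < o.2 + h%:Z].

Definition minimal_bounding_rectangle (P : {fset cell}) (o : cell)
    (w h : nat) : Prop :=
  [set` P] `<=` rectangle o w h /\
  forall (o' : cell) (w' h' : nat), [set` P] `<=` rectangle o' w' h' ->
    rectangle o w h `<=` rectangle o' w' h'.

Definition parallelogram_polyomino (w h : nat) (P : {fset cell}) : Prop :=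
  [/\ P != fset0, connected_cells P, rows_contiguous P, columns_contiguous P &
      exists o : cell, [/\ minimal_bounding_rectangle P o w h,
        o \in P & o + (w%:Z - 1, h%:Z - 1) \in P]].

Definition translate (v : cell) (P : {fset cell}) : {fset cell} :=
  [fset (c + v)%R | c in P]%fset.

Definition translation_class (P : {fset cell}) : set {fset cell} :=
  [set translate v P | v in [set: cell]].

(* Reflection about the line y = x; any other line of this direction gives the
   same image up to translation. *)
Definition d2 (P : {fset cell}) : {fset cell} :=
  [fset (c.2, c.1) | c in P]%fset.

Definition d2_symmetric (P : {fset cell}) : Prop :=
  exists v : cell, d2 P = translate v P.

Definition dyck_polyomino (h : nat) (P : {fset cell}) : Prop :=
  (1 <= h)%N /\
  exists a : nat -> nat,
    [/\ a 1%N = 1%N,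
        forall i : nat, (1 <= i)%N -> (i < h)%N ->
          (a i <= a i.+1)%N /\ (a i.+1 <= i)%N &
        forall c : cell, c \in P <->
          exists i : nat, [/\ (1 <= i <= h)%N, c.2 = i%:Z &
                              (a i)%:Z <= c.1 <= i%:Z]].

(* Number of elements of a finite set (fset_set A is empty if A is infinite;
   all the sets counted below are finite). *)
Definition count_set (T : choiceType) (A : set T) : int := #|` fset_set A|%:Z.

(* A Laurent monomial x^i y^j q^k is represented by its exponents (i, j, k), so
   that multiplying monomials is adding exponents. *)
Notation monomial := (int * int * int)%type.

Definition mon_x : monomial := (1, 0, 0).
Definition mon_y : monomial := (0, 1, 0).
Definition mon_q : monomial := (0, 0, 1).

(* Formal power series in y and q: coefficient of y^m q^n at (m, n). *)
Definition series_yq : Type := (nat * nat -> int)%type.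

(* Formal series in x^{+-1}, y^{+-1}, q^{+-1}, by their coefficients. *)
Definition laurent_series_xyq : Type := (monomial -> int)%type.

(* F(s, t) for Laurent monomials s and t. The coefficient of a monomial e is the
   sum of the coefficients F (m, n) over all (m, n) with s^m t^n = e; the series
   F(s, t) makes sense when each of these sums has finitely many nonzero terms,
   in particular when s and t are multiplicatively independent. *)
Definition subst_monomials (F : series_yq) (s t : monomial) :
    laurent_series_xyq :=
  fun e => \sum_(p \in [set p : nat * nat | s *+ p.1 + t *+ p.2 = e]) F p.

(* Polyominoes are considered up to translation: translation classes are
   counted. *)
Definition D2 : laurent_series_xyq := fun e =>
  count_set [set C : set {fset cell} | exists (w h : nat) (P : {fset cell}),
    [/\ parallelogram_polyomino w h P, d2_symmetric P,
        C = translation_class P &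
        mon_x *+ w + mon_y *+ h + mon_q *+ #|` P| = e]].

Definition D : series_yq := fun p =>
  count_set [set P : {fset cell} |
    dyck_polyomino p.1 P /\ #|` P|%fset = p.2].

(* Main.v *)
Require Import Defs.
From mathcomp Require Import all_boot all_order all_algebra.
From mathcomp Require Import finmap zify.
From mathcomp Require Import boolp classical_sets functions cardinality fsbigop.

Set Implicit Arguments.
Unset Strict Implicit.
Unset Printing Implicit Defensive.

Import Order.TTheory GRing.Theory Num.Theory.
Local Open Scope ring_scope.

(** A d2-symmetric parallelogram polyomino, placed so that the bottom-left cell
    of its bounding rectangle is (1, 1), is its own mirror image in the main
    diagonal. It is therefore determined by its cells (x, y) with x <= y, and
    these cells form a Dyck polyomino. Conversely, the union of a Dyck
    polyomino H of height h with its mirror image is a d2-symmetric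
    parallelogram polyomino of width and height h. The two halves share exactly
    the h cells of the diagonal, so the union has area 2 |H| - h, and a Dyck
    polyomino counted by y^h q^n corresponds to a polyomino of weight
    x^h y^h q^(2n - h) = (xy/q)^h (q^2)^n. This is the substitution in the
    statement; as h and n can be read off from that weight, no coefficient of
    the substituted series collects more than one term of D.

    Both directions go through an intrinsic description of Dyck polyominoes,
    [staircase]: all cells lie above the diagonal, the diagonal and the
    superdiagonal are filled, and every row and every column is filled
    between each of its cells and the diagonal. The delicate point is
    [staircase_upper_half]: the diagonal of a symmetric polyomino is filled. A
    path of cells from the bottom-left to the top-right corner has to leave
    the region max(x, y) < i, if i > 1, and to enter the quadrant
    min(x, y) >= i. By symmetry the two cells that it then reaches can be taken
    in row i, one to the left of the diagonal and one on it or to its right,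
    and contiguity of the row puts (i, i) in the polyomino. *)

(** * Paths of cells *)

(** Membership proofs are bundled inside, so that paths can be composed without
    transporting the dependent type of the cells of [P]. *)
Definition reachable (P : {fset cell}) (c d : cell) : Prop :=
  exists (cP : c \in P) (dP : d \in P),
    connect (fun u v : P => adjacent (fsval u) (fsval v))
      [` cP]%fset [` dP]%fset.

Lemma adjacent_sym c d : adjacent c d = adjacent d c.
Proof. by rewrite /adjacent; lia. Qed.

Lemma reachable_refl P c : c \in P -> reachable P c c.
Proof. by move=> cP; exists cP, cP; apply: connect0. Qed.

Lemma reachable_trans P d c e :
  reachable P c d -> reachable P d e -> reachable P c e.
Proof.
move=> [cP [dP cd]] [dP' [eP de]]; exists cP, eP.
by apply: connect_trans cd _; rewrite (bool_irrelevance dP dP').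
Qed.

Lemma reachable_sym P c d : reachable P c d -> reachable P d c.
Proof.
move=> [cP [dP cd]]; exists dP, cP; rewrite sym_connect_sym //.
by move=> u v; apply: adjacent_sym.
Qed.

Lemma reachable_step P c d :
  c \in P -> d \in P -> adjacent c d -> reachable P c d.
Proof. by move=> cP dP cd; exists cP, dP; apply: connect1. Qed.

Lemma reachable_row P x x' j : rows_contiguous P ->
  (x, j) \in P -> (x', j) \in P -> reachable P (x, j) (x', j).
Proof.
move=> rowP; wlog le_xx' : x x' / x <= x' => [IH xP x'P|].
  have [/IH|/ltW/IH] := lerP x x'; first exact.
  by move=> /(_ x'P xP)/reachable_sym.
have [n ->] : exists n : nat, x' = x + n%:Z by exists `|x' - x|%N; lia.
elim: n {le_xx' x'} => [|n IHn] xP x'P.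
  by rewrite addr0; apply: reachable_refl.
have nP : (x + n%:Z, j) \in P by apply: rowP xP x'P _ _; lia.
apply: reachable_trans (IHn xP nP) _.
by apply: reachable_step; rewrite // /adjacent /=; lia.
Qed.

Lemma reachable_column P i y y' : columns_contiguous P ->
  (i, y) \in P -> (i, y') \in P -> reachable P (i, y) (i, y').
Proof.
move=> colP; wlog le_yy' : y y' / y <= y' => [IH yP y'P|].
  have [/IH|/ltW/IH] := lerP y y'; first exact.
  by move=> /(_ y'P yP)/reachable_sym.
have [n ->] : exists n : nat, y' = y + n%:Z by exists `|y' - y|%N; lia.
elim: n {le_yy' y'} => [|n IHn] yP y'P.
  by rewrite addr0; apply: reachable_refl.
have nP : (i, y + n%:Z) \in P by apply: colP yP y'P _ _; lia.
apply: reachable_trans (IHn yP nP) _.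
by apply: reachable_step; rewrite // /adjacent /=; lia.
Qed.

(** Some step of a path from [S] to its complement leaves [S]. This is the only
    consequence of connectedness that is used below. *)
Lemma connected_crossing (P : {fset cell}) (S : pred cell) u v :
  connected_cells P -> u \in P -> v \in P -> S u -> ~~ S v ->
  exists c d, [/\ c \in P, d \in P, adjacent c d, S c & ~~ S d].
Proof.
move=> conP uP vP; have /connectP [p] := conP [` uP]%fset [` vP]%fset.
move=> + eq_v; have -> : v = fsval (last [` uP]%fset p) by rewrite -eq_v.
rewrite -[u]/(fsval [` uP]%fset); move: [` uP]%fset {eq_v} => c.
elim: p c => [|d p IHp] c /=; first by move=> _ ->.
move=> /andP[cd /IHp IH] Sc NSlast.
have [Sd|NSd] := boolP (S (fsval d)); first exact: IH.
by exists (fsval c), (fsval d); rewrite !fsvalP.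
Qed.

(** * Translations and reflections *)

Lemma in_translate v P c : (c \in translate v P) = (c - v \in P).
Proof.
apply/imfsetP/idP => [[d dP ->]|cP]; first by rewrite addrK.
by exists (c - v); rewrite ?subrK.
Qed.

Lemma in_d2 P (c : cell) : (c \in d2 P) = ((c.2, c.1) \in P).
Proof.
apply/imfsetP/idP => [[[x y] dP ->]//|cP].
by exists (c.2, c.1); case: c cP.
Qed.

Lemma d2K : involutive d2.
Proof. by move=> P; apply/fsetP => -[x y]; rewrite !in_d2. Qed.

Lemma d2U P Q : d2 (P `|` Q)%fset = (d2 P `|` d2 Q)%fset.
Proof. by apply/fsetP => c; rewrite !(in_d2, in_fsetU). Qed.

Lemma card_translate v P : #|` translate v P| = #|` P|.
Proof. exact/card_imfset/addIr. Qed.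

Lemma card_d2 P : #|` d2 P| = #|` P|.
Proof. by apply: card_imfset => -[x y] [x' y'] [-> ->]. Qed.

Lemma translate0 P : translate 0 P = P.
Proof. by apply/fsetP => c; rewrite in_translate subr0. Qed.

Lemma translateD u v P : translate u (translate v P) = translate (u + v) P.
Proof. by apply/fsetP => c; rewrite !in_translate opprD addrA. Qed.

Lemma translation_class_translate v P :
  translation_class (translate v P) = translation_class P.
Proof.
apply/seteqP; split => _ [u _ <-]; first by exists (u + v); rewrite ?translateD.
by exists (u - v); rewrite ?translateD ?subrK.
Qed.

Lemma translation_class_eq P Q :
  translation_class P = translation_class Q -> exists v, P = translate v Q.
Proof.
move=> eqPQ; have : translation_class P P by exists 0; rewrite ?translate0.
by rewrite eqPQ => -[v _ <-]; exists v.
Qed.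

(** * Dyck polyominoes as staircases above the diagonal *)

(** For [1 <= h], these are the Dyck polyominoes of height [h]. Without the
    sequence of row starts, the description treats rows and columns alike, as
    reflections require. *)
Definition staircase (h : nat) (H : {fset cell}) : Prop :=
  [/\ forall x y : int, (x, y) \in H -> [/\ 1 <= x, x <= y & y <= h%:Z],
      forall i : int, 1 <= i <= h%:Z -> (i, i) \in H,
      forall i : int, 1 <= i < h%:Z -> (i, i + 1) \in H,
      forall x x' y : int, (x, y) \in H -> x <= x' <= y -> (x', y) \in H &
      forall x y y' : int, (x, y) \in H -> x <= y' <= y -> (x, y') \in H].

Lemma dyck_staircase h H : dyck_polyomino h H -> staircase h H.
Proof.
move=> [h1 [a [a1 amono memH]]].
have rowE (x : int) (i : nat) : (1 <= i <= h)%N ->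
    ((x, i%:Z) \in H) = ((a i)%:Z <= x <= i%:Z).
  move=> ih; apply/idP/idP => [/memH [i' /= [_ [<-]]] //|axi].
  by apply/memH; exists i.
have a_le (i : nat) : (1 <= i <= h)%N -> (1 <= a i)%N /\ (a i <= i)%N.
  elim: i => // -[|i] IH ih; first by rewrite a1.
  by have /= := amono i.+1 isT; lia.
have a_mono (i j : nat) : (1 <= i)%N -> (i <= j)%N -> (j <= h)%N ->
    (a i <= a j)%N.
  move=> i1; elim: j => [|j IHj] ij jh; first lia.
  have [i_le|j_lt] := leqP i j; last by have -> : i = j.+1 by lia.
  by have := IHj i_le; have [|//|] := amono j; lia.
have natP (i : int) : 1 <= i <= h%:Z ->
    exists2 n : nat, i = n%:Z & (1 <= n <= h)%N.
  by move=> ih; exists `|i|%N; lia.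
have memP x y : (x, y) \in H ->
    exists i : nat, [/\ (1 <= i <= h)%N, y = i%:Z & (a i)%:Z <= x <= i%:Z].
  by move=> /memH.
split.
- by move=> x y /memP [i [ih -> axi]]; have := a_le i ih; split; lia.
- by move=> i /natP [n -> nh]; rewrite rowE //; have := a_le n nh; lia.
- move=> i ih; have /natP [n i_n nh] : 1 <= i <= h%:Z by lia.
  subst i; have -> : n%:Z + 1 = n.+1%:Z by lia.
  by rewrite rowE; [have [] := amono n|]; lia.
- by move=> x x' y /memP [i [ih -> axi]] xx'; rewrite rowE //; lia.
- move=> x y y' /memP [i [ih -> axi]] xy'.
  have /natP [n yn nh] : 1 <= y' <= h%:Z by have := a_le i ih; lia.
  by rewrite yn rowE //; have := a_mono n i; lia.
Qed.

(** The start [a i] of row [i] is the least column meeting the row. The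
    superdiagonal gives [a i.+1 <= i]; moving down from row [i.+1] to row [i] in
    column [a i.+1], which stays above the diagonal, gives [a i <= a i.+1]. *)
Lemma staircase_dyck h H : (1 <= h)%N -> staircase h H -> dyck_polyomino h H.
Proof.
move=> h1 [bound diag superdiag rowH colH]; split=> //.
pose a (i : nat) := find (fun x : nat => (x%:Z, i%:Z) \in H) (iota 0 i.+1).
have has_a (i x : nat) : (x <= i)%N -> (x%:Z, i%:Z) \in H ->
    has (fun x : nat => (x%:Z, i%:Z) \in H) (iota 0 i.+1).
  by move=> xi xH; apply/hasP; exists x; rewrite // mem_iota; lia.
have a_le (i x : nat) : (x%:Z, i%:Z) \in H -> (a i <= x)%N.
  move=> xH; rewrite leqNgt; apply/negP => x_lt.
  have := before_find 0%N x_lt; rewrite nth_iota ?add0n ?xH //.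
  by have [] := bound _ _ xH; lia.
have aP (i : nat) : (1 <= i <= h)%N -> ((a i)%:Z, i%:Z) \in H.
  move=> ih; have iiH : (i%:Z, i%:Z) \in H by apply: diag; lia.
  have := nth_find 0%N (has_a _ _ (leqnn i) iiH).
  by rewrite nth_iota ?add0n // ltnS; apply: a_le.
exists a; split.
- by have [|] := bound _ _ (aP 1%N _); lia.
- move=> i i1 ih.
  have aSi : (a i.+1 <= i)%N.
    by apply: a_le; have := superdiag i%:Z; rewrite intS addrC; apply; lia.
  split=> //; apply: a_le; apply: colH (aP i.+1 _) _; lia.
- move=> [x y]; split=> [xyH|[i /= [ih -> axi]]].
    have [x1 xy yh] := bound _ _ xyH.
    have [m [n [xm yn]]] : exists m n : nat, x = m%:Z /\ y = n%:Z.
      by exists `|x|%N, `|y|%N; lia.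
    subst x y; exists n; split=> //=; first lia.
    by have := a_le n m xyH; lia.
  by apply: rowH (aP i ih) _.
Qed.

(** * The symmetric polyomino obtained from a staircase *)

Lemma staircase_diag h H (x : int) :
  staircase h H -> ((x, x) \in H) = (1 <= x <= h%:Z).
Proof.
move=> [bound diag _ _ _]; apply/idP/idP => [/bound[]|/diag //]; lia.
Qed.

Definition mirror_union (H : {fset cell}) : {fset cell} := (H `|` d2 H)%fset.

Lemma in_mirror_union H (x y : int) :
  ((x, y) \in mirror_union H) = ((x, y) \in H) || ((y, x) \in H).
Proof. by rewrite in_fsetU in_d2. Qed.

Lemma d2_mirror_union H : d2 (mirror_union H) = mirror_union H.
Proof. by rewrite d2U d2K fsetUC. Qed.

Lemma mirror_union_half h H (x y : int) : staircase h H ->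
  ((x, y) \in H) = (x <= y) && ((x, y) \in mirror_union H).
Proof.
move=> [bound _ _ _ _]; rewrite in_mirror_union.
apply/idP/idP => [xyH|]; first by rewrite xyH andbT; have [] := bound _ _ xyH.
case/andP=> xy /orP[//|yxH]; have [_ yx _] := bound _ _ yxH.
by move: yxH; have -> : x = y by lia.
Qed.

Lemma mirror_union_bound h H (x y : int) : staircase h H ->
  (x, y) \in mirror_union H -> (1 <= x <= h%:Z) && (1 <= y <= h%:Z).
Proof.
move=> [bound _ _ _ _]; rewrite in_mirror_union.
by case/orP=> /bound[]; lia.
Qed.

(** The two halves overlap in the [h] cells of the diagonal. *)
Lemma card_mirror_union h H :
  staircase h H -> (#|` mirror_union H| + h = #|` H| * 2)%N.
Proof.
move=> stH; have [bound _ _ _ _] := stH.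
have -> : h = #|` (H `&` d2 H)%fset|.
  pose diagonal := [fset (n.+1%:Z, n.+1%:Z) | n in iota 0 h]%fset.
  have -> : (H `&` d2 H)%fset = diagonal.
    apply/fsetP => -[x y]; rewrite in_fsetI in_d2 /=.
    apply/andP/imfsetP => [[xyH yxH]|[n /= nh [-> ->]]].
      have [x1 xy yh] := bound _ _ xyH; have [_ yx _] := bound _ _ yxH.
      exists `|x|.-1%N; first by rewrite /= mem_iota; lia.
      by congr pair; lia.
    rewrite (staircase_diag _ stH).
    by move: nh; rewrite mem_iota; lia.
  rewrite card_in_imfset /=; last by move=> m n _ _ [] ?; lia.
  by rewrite undup_id ?iota_uniq // size_iota.
rewrite cardfsU card_d2; have := fsubset_leq_card (fsubsetIl H (d2 H)); lia.
Qed.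

(** A cell (i, j) between two cells of row [j] lies between the diagonal cell
    (j, j) and one of them: on the left this is a piece of a row of [H], on the
    right a piece of the mirror image of a column of [H]. *)
Lemma mirror_union_rows h H :
  staircase h H -> rows_contiguous (mirror_union H).
Proof.
move=> stH; have [_ _ _ rowH colH] := stH.
move=> i1 i i2 j Hi1 Hi2 i1i ii2.
rewrite in_mirror_union; apply/orP; have [ij|ji] := lerP i j.
  left; apply: (rowH i1); last lia.
  by rewrite (mirror_union_half _ _ stH) Hi1; lia.
right; apply: (colH j i2); last lia.
rewrite (mirror_union_half _ _ stH) in_mirror_union orbC -in_mirror_union Hi2.
lia.
Qed.

Lemma mirror_union_columns h H :
  staircase h H -> columns_contiguous (mirror_union H).
Proof.
move=> stH; have swapE (x y : int) :
    ((x, y) \in mirror_union H) = ((y, x) \in mirror_union H).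
  by rewrite !in_mirror_union orbC.
move=> i j1 j j2; rewrite (swapE i j1) (swapE i j2) (swapE i j).
exact: mirror_union_rows stH _ _ _ _.
Qed.

(** Every cell is joined along its row to the diagonal, and consecutive diagonal
    cells are joined through the superdiagonal cell between them. *)
Lemma mirror_union_connected h H :
  staircase h H -> connected_cells (mirror_union H).
Proof.
move=> stH; have [_ diag superdiag _ _] := stH.
have diagM i : 1 <= i <= h%:Z -> (i, i) \in mirror_union H.
  by move=> /diag iH; rewrite in_mirror_union iH.
have reach_diag (n : nat) : (n < h)%N ->
    reachable (mirror_union H) (1, 1) (n.+1%:Z, n.+1%:Z).
  elim: n => [|n IHn] nh; first by apply/reachable_refl/diagM; lia.
  have sM : (n.+1%:Z, n.+2%:Z) \in mirror_union H.
    by rewrite in_mirror_union [n.+2%:Z]intS addrC superdiag //; lia.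
  apply: (reachable_trans (d := (n.+1%:Z, n.+2%:Z))).
    apply: reachable_trans (IHn _) _; first lia.
    apply: reachable_column (mirror_union_columns stH) _ sM.
    by apply: diagM; lia.
  by apply: reachable_row (mirror_union_rows stH) sM _; apply: diagM; lia.
have reach c : c \in mirror_union H -> reachable (mirror_union H) (1, 1) c.
  case: c => x y xyM; have xyh := mirror_union_bound stH xyM.
  have [n [yn nh]] : exists n : nat, y = n.+1%:Z /\ (n < h)%N.
    by exists `|y|.-1%N; lia.
  subst y; apply: reachable_trans (reach_diag n nh) _.
  by apply: reachable_row (mirror_union_rows stH) _ xyM; apply: diagM; lia.
move=> u v.
have := reachable_trans (reachable_sym (reach _ (fsvalP u)))
  (reach _ (fsvalP v)).
by case=> uM [vM]; rewrite !fsetsubE.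
Qed.

Lemma mirror_union_parallelogram h H : (1 <= h)%N -> staircase h H ->
  parallelogram_polyomino h h (mirror_union H).
Proof.
move=> h1 stH.
have diagM (i : int) : 1 <= i <= h%:Z -> (i, i) \in mirror_union H.
  by rewrite in_mirror_union (staircase_diag _ stH) => ->.
have oM : (1, 1) \in mirror_union H by apply: diagM; lia.
have hM : (h%:Z, h%:Z) \in mirror_union H by apply: diagM; lia.
split.
- by apply/fset0Pn; exists (1, 1).
- exact: mirror_union_connected stH.
- exact: mirror_union_rows stH.
- exact: mirror_union_columns stH.
exists (1, 1); split=> //.
  (* Any rectangle containing the cells (1, 1) and (h, h) contains everything
     between them. *)
  split=> [[x y] /(mirror_union_bound stH)|o' w' h' sub [x y]].
    by rewrite /rectangle /=; lia.
  have := sub _ oM; have := sub _ hM; rewrite /rectangle /=; lia.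
suff -> : (1, 1) + (h%:Z - 1, h%:Z - 1) = (h%:Z, h%:Z) :> cell by [].
by congr pair; rewrite /= addrC subrK.
Qed.

(** The union determines the staircase: its bottom-left cell (1, 1) fixes the
    translation, and the staircase is then the part above the diagonal. *)
Lemma mirror_union_inj h h' H H' : (1 <= h)%N -> (1 <= h')%N ->
  staircase h H -> staircase h' H' ->
  translation_class (mirror_union H) = translation_class (mirror_union H') ->
  H = H'.
Proof.
move=> h1 h'1 stH stH' /translation_class_eq [[v1 v2] eqM].
have cornerM k K : (1 <= k)%N -> staircase k K -> (1, 1) \in mirror_union K.
  by move=> k1 stK; rewrite in_mirror_union (staircase_diag _ stK); lia.
have vM (x y : int) :
    ((x + v1, y + v2) \in mirror_union H) = ((x, y) \in mirror_union H').
  rewrite eqM in_translate; congr (_ \in mirror_union H').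
  by congr pair; rewrite /= addrK.
have [v10 v20] : v1 = 0 /\ v2 = 0.
  have := cornerM _ _ h'1 stH'; rewrite -vM => /(mirror_union_bound stH).
  have := vM (1 - v1) (1 - v2); rewrite !subrK (cornerM _ _ h1 stH).
  by move=> /esym /(mirror_union_bound stH'); lia.
apply/fsetP => -[x y].
rewrite (mirror_union_half _ _ stH) (mirror_union_half _ _ stH') -vM.
by rewrite v10 v20 !addr0.
Qed.

(** * The staircase inside a symmetric polyomino *)

(** The cells whose translates are reachable from a given cell cannot be left
    through an adjacent pair. *)
Lemma connected_translate v P :
  connected_cells P -> connected_cells (translate v P).
Proof.
move=> conP a b; apply: contrapT => Nab.
pose S c := `[< reachable (translate v P) (fsval a) (c + v) >].
have aP : fsval a - v \in P by rewrite -in_translate fsvalP.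
have bP : fsval b - v \in P by rewrite -in_translate fsvalP.
have [||c [d [cP dP cd /asboolP Sc /asboolP[]]]] :=
  connected_crossing (S := S) conP aP bP.
- by apply/asboolP; rewrite subrK; apply/reachable_refl/fsvalP.
- apply/asboolP; rewrite subrK => -[aT [bT]]; by rewrite !fsetsubE.
apply: reachable_trans Sc _; apply: reachable_step.
- by rewrite in_translate addrK.
- by rewrite in_translate addrK.
- by move: cd; rewrite /adjacent /=; lia.
Qed.

Lemma rows_translate v P :
  rows_contiguous P -> rows_contiguous (translate v P).
Proof.
move=> rowP i1 i i2 j; rewrite !in_translate => P1 P2 i1i ii2.
by apply: (rowP (i1 - v.1) (i - v.1) (i2 - v.1) (j - v.2)); rewrite ?lerD2r.
Qed.

Lemma columns_translate v P :
  columns_contiguous P -> columns_contiguous (translate v P).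
Proof.
move=> colP i j1 j j2; rewrite !in_translate => P1 P2 j1j jj2.
by apply: (colP (i - v.1) (j1 - v.2) (j - v.2) (j2 - v.2)); rewrite ?lerD2r.
Qed.

Definition upper_half (Q : {fset cell}) : {fset cell} :=
  [fset c in Q | c.1 <= c.2]%fset.

Lemma mirror_union_upper_half Q : d2 Q = Q -> mirror_union (upper_half Q) = Q.
Proof.
move=> symQ; apply/fsetP => -[x y]; rewrite in_mirror_union !inE /=.
have -> : ((y, x) \in Q) = ((x, y) \in Q) by rewrite -{1}symQ in_d2.
by rewrite -andb_orr le_total andbT.
Qed.

(** Row [i + 1] has a cell to the left of the diagonal, reached where a path
    from (1, 1) to (n, n) makes max(x, y) exceed [i] (claim [lower]), and row
    [i] has one on the diagonal or to its right, where min(x, y) reaches [i]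
    (claim [upper]); a reflection puts these cells in a row if they were
    found in a column. So the diagonal is filled, and with it everything that
    lies in a row or column between a cell and the diagonal. *)
Lemma staircase_upper_half n Q :
  connected_cells Q -> rows_contiguous Q -> columns_contiguous Q ->
  d2 Q = Q ->
  (forall x y : int, (x, y) \in Q -> (1 <= x <= n%:Z) && (1 <= y <= n%:Z)) ->
  (1, 1) \in Q -> (n%:Z, n%:Z) \in Q -> staircase n (upper_half Q).
Proof.
move=> conQ rowQ colQ symQ bound oQ nQ.
have swapQ (x y : int) : (x, y) \in Q -> (y, x) \in Q.
  by rewrite -{1}symQ in_d2.
have lower i : 1 <= i < n%:Z -> exists2 x, x <= i & (x, i + 1) \in Q.
  move=> i_n; pose S (c : cell) := (c.1 <= i) && (c.2 <= i).
  have [||[x y] [[x' y'] [_ dQ]]] := connected_crossing (S := S) conQ oQ nQ.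
  - by rewrite /S /=; lia.
  - by rewrite /S /=; lia.
  rewrite /S /adjacent /= => adj Sc NSd.
  have [[x'_eq y'_le]|[x'_le y'_eq]] :
      (x' = i + 1 /\ y' <= i) \/ (x' <= i /\ y' = i + 1) by lia.
    by exists y' => //; apply: swapQ; rewrite -x'_eq.
  by exists x'; rewrite // -y'_eq.
have upper i : 1 < i <= n%:Z -> exists2 x, i <= x & (x, i) \in Q.
  move=> i_n; pose S (c : cell) := (c.1 < i) || (c.2 < i).
  have [||[x y] [[x' y'] [_ dQ]]] := connected_crossing (S := S) conQ oQ nQ.
  - by rewrite /S /=; lia.
  - by rewrite /S /=; lia.
  rewrite /S /adjacent /= => adj Sc NSd.
  have [[x'_eq y'_ge]|[x'_ge y'_eq]] :
      (x' = i /\ i <= y') \/ (i <= x' /\ y' = i) by lia.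
    by exists y' => //; apply: swapQ; rewrite -x'_eq.
  by exists x'; rewrite // -y'_eq.
have diag i : 1 <= i <= n%:Z -> (i, i) \in Q.
  move=> i_n; have [->//|i_neq1] := eqVneq i 1.
  have [|x x_lt xQ] := lower (i - 1); first lia.
  have [|x' x'_ge x'Q] := upper i; first lia.
  by rewrite subrK in xQ; apply: rowQ xQ x'Q _ _; lia.
split.
- by move=> x y; rewrite !inE /= => /andP[/bound xy_n xy]; split; lia.
- by move=> i /diag iQ; rewrite !inE /= iQ lexx.
- move=> i i_n; rewrite !inE /=; apply/andP; split; last lia.
  have [x x_le xQ] := lower i i_n.
  have SQ : (i + 1, i + 1) \in Q by apply: diag; lia.
  by apply: rowQ xQ SQ _ _; lia.
- move=> x x' y; rewrite !inE /= => /andP[xyQ xy] xx'.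
  have yQ : (y, y) \in Q by apply: diag; have := bound _ _ xyQ; lia.
  by apply/andP; split; [apply: rowQ xyQ yQ _ _|]; lia.
- move=> x y y'; rewrite !inE /= => /andP[xyQ xy] xy'.
  have xQ : (x, x) \in Q by apply: diag; have := bound _ _ xyQ; lia.
  by apply/andP; split; [apply: colQ xQ xyQ _ _|]; lia.
Qed.

(** A symmetry of [P] up to translation exchanges the two extents of the
    bounding rectangle, so this is a square and the translation takes
    [o] to its reflection. Moving [o] to (1, 1) makes the polyomino
    genuinely invariant under [d2]. *)
Lemma symmetric_parallelogram_fold w h P :
  parallelogram_polyomino w h P -> d2_symmetric P ->
  [/\ w = h, (1 <= h)%N & exists u H,
     staircase h H /\ P = translate u (mirror_union H)].
Proof.
move=> [_ conP rowP colP [[o1 o2] [[sub _] oP topP]]] [[v1 v2] symP].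
have bound (x y : int) : (x, y) \in P ->
    (o1 <= x < o1 + w%:Z) && (o2 <= y < o2 + h%:Z).
  by move=> /sub[/= ? ?]; apply/andP.
have swapP (x y : int) : ((y + v2, x + v1) \in P) = ((x, y) \in P).
  have := in_translate (v1, v2) P (x + v1, y + v2).
  rewrite -symP in_d2 /= => ->.
  by congr (_ \in P); congr pair; rewrite /= addrK.
have swap_oP : (o2 + v2, o1 + v1) \in P by rewrite swapP.
have unswap_oP : (o2 - v1, o1 - v2) \in P by rewrite -swapP !subrK.
(* The bottom-left corner is mapped into P by the symmetry and by its
   inverse; the bounds on both images leave one value for v. *)
have [v1E v2E] : v1 = o2 - o1 /\ v2 = o1 - o2.
  by have := bound _ _ swap_oP; have := bound _ _ unswap_oP; lia.
have {}topP : (o1 + (w%:Z - 1), o2 + (h%:Z - 1)) \in P by [].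
have wh : w = h.
  have := topP; rewrite -swapP => /bound.
  by have := bound _ _ topP; lia.
have h1 : (1 <= h)%N by have := bound _ _ oP; lia.
split=> //; subst w.
set Q := translate (1 - o1, 1 - o2) P.
have inQ (x y : int) : ((x, y) \in Q) = ((x - (1 - o1), y - (1 - o2)) \in P).
  exact: in_translate.
have symQ : d2 Q = Q.
  apply/fsetP => -[x y]; rewrite in_d2 /= !inQ -swapP.
  by congr (_ \in P); congr pair; lia.
exists (o1 - 1, o2 - 1), (upper_half Q); split.
  apply: staircase_upper_half => //.
  - exact: connected_translate.
  - exact: rows_translate.
  - exact: columns_translate.
  - by move=> x y; rewrite inQ => /bound; lia.
  - by rewrite inQ !subKr.
  - rewrite inQ; suff -> : (h%:Z - (1 - o1), h%:Z - (1 - o2)) =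
        (o1 + (h%:Z - 1), o2 + (h%:Z - 1)) by [].
    by congr pair; lia.
rewrite mirror_union_upper_half // translateD -[LHS]translate0.
by congr translate; congr pair; rewrite /=; lia.
Qed.

(** * Generating series *)

(** Also true for infinite [A]: both counts are then the default value 0. *)
Lemma count_set_image (T U : choiceType) (f : T -> U) (A : set T) :
  {in A &, injective f} -> count_set (f @` A)%classic = count_set A.
Proof.
move=> f_inj; rewrite /count_set; congr Posz.
have [finA|infA] := pselect (finite_set A).
  rewrite fset_set_image // card_in_imfset // => x y.
  by rewrite !in_fset_set //; apply: f_inj.
have infB : ~ finite_set (f @` A)%classic.
  by rewrite (eq_finite_set (inj_card_eq f_inj)).
by rewrite /fset_set; do 2![case: pselect => // _].
Qed.

Lemma monomialE (i j k : int) (w h n : nat) :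
  (mon_x *+ w + mon_y *+ h + mon_q *+ n = (i, j, k)) <->
  [/\ w%:Z = i, h%:Z = j & n%:Z = k].
Proof.
rewrite !pairMnE /= !mul0rn !natz.
rewrite -[_ + _ + _]/(w%:Z + 0 + 0, 0 + h%:Z + 0, 0 + 0 + n%:Z).
by rewrite !addr0 !add0r; split=> [[<- <- <-]|[<- <- <-]].
Qed.

Lemma subst_monomialE (i j k : int) (m n : nat) :
  ((mon_x + mon_y - mon_q) *+ m + (mon_q *+ 2) *+ n = (i, j, k)) <->
  [/\ m%:Z = i, m%:Z = j & (n * 2)%:Z - m%:Z = k].
Proof.
rewrite !pairMnE /= !addr0 !add0r !mul0rn !natz.
rewrite -[_ + _]/(m%:Z + 0, m%:Z + 0, -1 *+ m + 2 *+ n) !addr0.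
have -> : -1 *+ m + 2 *+ n = (n * 2)%:Z - m%:Z :> int by lia.
by split=> [[<- <- <-]|[<- <- <-]].
Qed.

Theorem proposition7 :
  D2 = subst_monomials D (mon_x + mon_y - mon_q) (mon_q *+ 2).
Proof.
apply/funext => -[[i j] k].
pose half_weight : set {fset cell} := fun H => exists m n : nat,
  [/\ dyck_polyomino m H, #|` H|%fset = n &
      (mon_x + mon_y - mon_q) *+ m + (mon_q *+ 2) *+ n = (i, j, k)].
(* Left side: the staircases are in bijection with the symmetric classes. *)
transitivity (count_set half_weight).
  rewrite -(count_set_image (f := fun H => translation_class (mirror_union H))).
    congr count_set; apply/seteqP; split.
      move=> _ [w [h [P [parP symP -> /monomialE [wi hj nk]]]]].
      have [wh h1 [u [H [stH PE]]]] := symmetric_parallelogram_fold parP symP.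
      exists H; last by rewrite PE translation_class_translate.
      exists h, #|` H|%fset; split=> //; first exact: staircase_dyck.
      apply/subst_monomialE; rewrite -wi -hj -nk wh PE card_translate.
      by split=> //; have := card_mirror_union stH; lia.
    move=> _ [H [m [n [dyH Hn /subst_monomialE [mi mj nk]]]] <-].
    have stH := dyck_staircase dyH; have [m1 _] := dyH.
    exists m, m, (mirror_union H); split=> //.
    - exact: mirror_union_parallelogram.
    - by exists 0; rewrite translate0 d2_mirror_union.
    - apply/monomialE; split=> //.
      by have := card_mirror_union stH; rewrite Hn; lia.
  move=> H H' /set_mem [m [n [dyH _ _]]] /set_mem [m' [n' [dyH' _ _]]].
  have [[m1 _] [m'1 _]] := (dyH, dyH').
  by apply: mirror_union_inj m1 m'1 (dyck_staircase dyH) (dyck_staircase dyH').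
(* Right side: at most one pair of exponents contributes. *)
rewrite /subst_monomials.
have [[[m n] /subst_monomialE [/= mi mj nk]]|none] :=
  pselect (exists p : nat * nat,
    (mon_x + mon_y - mon_q) *+ p.1 + (mon_q *+ 2) *+ p.2 = (i, j, k)).
  have -> : [set p : nat * nat | (mon_x + mon_y - mon_q) *+ p.1 +
      (mon_q *+ 2) *+ p.2 = (i, j, k)]%classic = [set (m, n)]%classic.
    apply/seteqP; split=> [[m' n']|p ->].
      by move=> /subst_monomialE [/= m'i _ n'k]; congr pair; lia.
    exact/subst_monomialE.
  rewrite fsbig_set1 /D; congr count_set; apply/seteqP; split.
    move=> H [m' [n' [dyH Hn /subst_monomialE [m'i _ n'k]]]].
    have -> : m = m' by lia.
    by split=> //=; rewrite Hn; lia.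
  by move=> H [dyH Hn]; exists m, n; split=> //; apply/subst_monomialE.
have -> : half_weight = set0.
  by rewrite -subset0 => H [m [n [_ _ mn_e]]]; apply: none; exists (m, n).
rewrite (_ : [set _ | _]%classic = set0); last first.
  by rewrite -subset0 => p mn_e; apply: none; exists p.
by rewrite fsbig_set0 /count_set fset_set0 cardfs0.
Qed.
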